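(* Let $X$ be a real locally convex topological vector space, and let $P$ and $\Omega$ be nonempty convex subsets of $X$, where $P$ is a convex polyhedron. Assume that $P\cap \mathrm{qri}(\Omega)\neq\emptyset$. Then $$N(\bar x;P\cap\Omega)=N(\bar x;P)+N(\bar x;\Omega)\quad\text{for all }\bar x\in P\cap\Omega.$$
   Context: $X^*$ is the topological dual of $X$ and $\langle x^*,x\rangle:=x^*(x)$. For a nonempty $A\subset X$, $\mathrm{cone}(A):=\{ta\mid t\ge 0,\ a\in A\}$. The quasi-relative interior of a convex set $\Omega\subset X$ is $\mathrm{qri}(\Omega):=\{x\in\Omega\mid \overline{\mathrm{cone}(\Omega-x)}\text{ is a linear subspace of }X\}$. A set $P\subset X$ is a convex polyhedron (polyhedral set) if there are finitely many $x_i^*\in X^*$, $\alpha_i\in\mathbb{R}$, $i=1,\dots,k$, with $P=\{x\in X\mid\langle x_i^*,x\rangle\le\alpha_i,\ i=1,\dots,k\}$. The normal cone to a convex set $\Omega$ at $\bar x\in\Omega$ is $N(\bar x;\Omega):=\{x^*\in X^*\mid\langle x^*,x-\bar x\rangle\le 0\text{ for all }x\in\Omega\}$, and $N(\bar x;\Omega):=\emptyset$ if $\bar x\notin\Omega$. *)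

(* Defs.v *)
From mathcomp Require Import all_boot all_order all_algebra.
From mathcomp Require Import boolp classical_sets functions reals.
From mathcomp Require Import convex topology normedtype.

Set Implicit Arguments.
Unset Strict Implicit.
Unset Printing Implicit Defensive.

Import Order.TTheory GRing.Theory Num.Theory.
Import numFieldNormedType.Exports.

Local Open Scope classical_set_scope.
Local Open Scope ring_scope.

(* [tvsType R] is locally convex; it is not assumed to be Hausdorff. *)

(* X^* as a set of functions, so that its addition is the pointwise one. *)
Definition dual (R : realType) (X : tvsType R) : set (X -> R) :=
  [set f : X -> R | scalar f /\ continuous f].

Definition minkowski_sum (V : zmodType) (A B : set V) : set V :=
  [set a + b | a in A & b in B].

Definition cone (R : realType) (X : tvsType R) (A : set X) : set X :=
  [set t *: a | t in [set t : R | 0 <= t] & a in A].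

Definition qri (R : realType) (X : tvsType R) (Omega : set X) : set X :=
  [set x | Omega x /\
     submod_closed [in closure (cone [set y - x | y in Omega])]].

Definition polyhedron (R : realType) (X : tvsType R) (P : set X) : Prop :=
  exists (k : nat) (f : 'I_k -> X -> R) (alpha : 'I_k -> R),
    (forall i, dual (f i)) /\ P = [set x | forall i, f i x <= alpha i].

(* Empty when [xbar] is not in [Omega]. *)
Definition normal_cone (R : realType) (X : tvsType R) (xbar : X)
    (Omega : set X) : set (X -> R) :=
  [set f | [/\ Omega xbar, dual f & forall x, Omega x -> f (x - xbar) <= 0]].

(* Main.v *)
Require Import Defs.
From mathcomp Require Import all_boot all_order all_algebra.
From mathcomp Require Import boolp classical_sets functions reals.
From mathcomp Require Import convex topology normedtype.
From mathcomp Require Import interval_inference ring lra.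

Set Implicit Arguments.
Unset Strict Implicit.
Unset Printing Implicit Defensive.

Import Order.TTheory GRing.Theory Num.Theory.
Import numFieldNormedType.Exports.

Local Open Scope classical_set_scope.
Local Open Scope ring_scope.

(** The inclusion from right to left is immediate. For the other one, let [g]
    be normal to [P `&` Omega] at [xbar], where [P] is cut out by the
    inequalities [f i <= alpha i]. Thus [g] is at most [g xbar] on the part of
    [Omega] satisfying finitely many affine inequalities, and it is enough to
    find Lagrange multipliers [lam i >= 0] such that, on the whole of [Omega],
    [g <= g xbar + \sum_i lam i * (f i - alpha i)]. Evaluating at [xbar] gives
    complementary slackness, so that [\sum_i lam i * f i] is normal to [P] and
    [g - \sum_i lam i * f i] is normal to [Omega].

    Quasi-relative interiority of [x0] enters only through one consequence: a
    continuous linear functional that attains its maximum over [Omega] at [x0]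
    is constant on [Omega] ([quasi_interior], [qri_quasi_interior]). This
    property passes to the slice of a convex set by a hyperplane through [x0],
    to its intersection with a half-space containing [x0] in its open part, and
    to the midpoint of [x0] and any point of the set. It therefore supports an
    induction on the number of constraints ([polyhedral_multipliers]) that
    needs no separation theorem: the only analytic ingredient is the supremum
    of slopes that yields the multiplier of one hyperplane
    ([crossing_multiplier]).

    In the inductive step let [h <= a] be the constraint to remove. If some
    feasible point satisfies it strictly, one can move [x0] towards that point
    and use the classical Slater argument. If not, [h >= a] is implied by the
    other constraints, and the induction hypothesis, applied to [- h], bounds
    [a - h] above by a nonnegative combination of the other constraint
    functions [f i - alpha i]. Relaxing the slice [h = a] to the whole set may
    produce a negative multiplier for [h], but adding a large multiple of that
    bound makes it nonnegative. *)

(** * Continuous linear functionals and convexity *)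

Section Dual.
Variables (R : realType) (X : tvsType R).
Implicit Types (f g : X -> R) (C : set X).

Lemma dual_combination f (a b : R) (x y : X) :
  dual f -> f (a *: x + b *: y) = a * f x + b * f y.
Proof.
move=> [fl _]; rewrite fl; congr (_ + _).
have f0 : f 0 = 0 by have := fl 1 0 0; rewrite scale1r addr0 /=; lra.
by have := fl b y 0; rewrite !addr0 f0 addr0.
Qed.

Lemma dualB f (x y : X) : dual f -> f (x - y) = f x - f y.
Proof.
move=> df; have := dual_combination 1 (-1) x y df.
by rewrite scale1r scaleN1r mul1r mulN1r.
Qed.

Lemma dual_axpy f g (a : R) :
  dual f -> dual g -> dual (fun x => a * f x + g x).
Proof.
move=> [fl fc] [gl gc]; split.
  by move=> t x y; rewrite fl gl /=; ring.
by move=> x; apply: cvgD (gc x); apply: cvgM (fc x); exact: cvg_cst.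
Qed.

Lemma dual0 : dual (fun _ : X => 0 : R).
Proof.
split; last by move=> x; exact: cst_continuous.
by move=> t x y /=; rewrite mulr0 addr0.
Qed.

Lemma dualN f : dual f -> dual (fun x => - f x).
Proof.
move=> df; rewrite (_ : (fun x => - f x) = (fun x => -1 * f x + 0)).
  exact: dual_axpy df dual0.
by apply/funext => x; rewrite addr0 mulN1r.
Qed.

Lemma dual_sum k (f : 'I_k -> X -> R) (c : 'I_k -> R) :
  (forall i, dual (f i)) -> dual (fun x => \sum_i c i * f i x).
Proof.
elim: k f c => [|k IH] f c df.
  rewrite (_ : (fun _ => _) = fun=> 0); first exact: dual0.
  by apply/funext => x; rewrite big_ord0.
rewrite (_ : (fun _ => _) = fun x => c ord0 * f ord0 x +
    \sum_(i < k) c (lift ord0 i) * f (lift ord0 i) x).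
  by apply: dual_axpy; [exact: df|exact: IH].
by apply/funext => x; rewrite big_ord_recl.
Qed.

Lemma convex_segment C (x y : X) (t : R) : convex_set C -> C x -> C y ->
  0 <= t <= 1 -> C (t *: x + (1 - t) *: y).
Proof.
move=> Ccvx Cx Cy /andP[t0 t1].
by have := Ccvx x y (Itv01 t0 t1); rewrite !inE; exact.
Qed.

Lemma convex_slice C (A : set R) f : convex_set C -> dual f ->
  (forall s u t : R, 0 <= t <= 1 -> A s -> A u -> A (t * s + (1 - t) * u)) ->
  convex_set (C `&` f @^-1` A).
Proof.
move=> Ccvx df Acvx x y t; rewrite !inE => -[Cx Ax] [Cy Ay].
have t01 : 0 <= t%:num <= 1 by apply/andP.
have -> : conv t x y = t%:num *: (x : X) + (1 - t%:num) *: (y : X) by [].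
split; first exact: convex_segment.
by rewrite /preimage /= dual_combination //; exact: Acvx.
Qed.

End Dual.

(** * The multiplier of a single hyperplane *)

Section Multipliers.
Variables (R : realType) (X : tvsType R).
Implicit Types (f g h : X -> R) (C : set X) (x y : X).

(** When [C] meets both open sides of the hyperplane [h = a], the bound on the
    slice makes the slopes [(g x - b) / (h x - a)] over the points of [C] on
    the positive side at most those over the points on the negative side: the
    segment between two such points crosses the slice. The supremum of the
    former slopes then separates both families. *)
Lemma crossing_multiplier C g h (a b : R) y z : convex_set C ->
  dual g -> dual h -> (forall x, C x -> h x = a -> g x <= b) ->
  C y -> h y < a -> C z -> a < h z ->
  exists mu, forall x, C x -> g x <= b + mu * (h x - a).
Proof.
move=> Ccvx dg dh gb Cy hy Cz hz.
have cross x w : C x -> a < h x -> C w -> h w < a ->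
    (g x - b) * (a - h w) <= (b - g w) * (h x - a).
  move=> Cx hx Cw hw.
  have d0 : 0 < h x - h w by lra.
  pose t := (a - h w) / (h x - h w).
  have td : t * (h x - h w) = a - h w by rewrite divfK // gt_eqF.
  have t01 : 0 <= t <= 1.
    by rewrite /t ler_pdivlMr // ler_pdivrMr // mul0r mul1r; lra.
  have := gb _ (convex_segment Ccvx Cx Cw t01).
  rewrite !dual_combination // => /(_ ltac:(lra)) le_b.
  have : (t * g x + (1 - t) * g w) * (h x - h w) <= b * (h x - h w).
    by rewrite ler_pM2r.
  have -> : (t * g x + (1 - t) * g w) * (h x - h w) =
    t * (h x - h w) * g x + (h x - h w - t * (h x - h w)) * g w by ring.
  by rewrite td; lra.
pose S := [set (g x - b) / (h x - a) | x in [set x | C x /\ a < h x]].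
have Sle w : C w -> h w < a -> ubound S ((b - g w) / (a - h w)).
  move=> Cw hw _ [x [Cx hx] <-].
  rewrite ler_pdivrMr ?subr_gt0 // mulrAC ler_pdivlMr ?subr_gt0 //.
  exact: cross.
exists (sup S) => x Cx; case: (ltgtP (h x) a) => hx.
- have : sup S <= (b - g x) / (a - h x).
    by apply: ge_sup (Sle _ Cx hx); exists ((g z - b) / (h z - a)); exists z.
  by rewrite ler_pdivlMr ?subr_gt0 //; lra.
- have : (g x - b) / (h x - a) <= sup S.
    by apply: ub_le_sup; [exists ((b - g y) / (a - h y)); exact: Sle|exists x].
  by rewrite ler_pdivrMr ?subr_gt0 //; lra.
- by rewrite hx subrr mulr0 addr0; exact: gb.
Qed.

(** The multiplier of the hyperplane [h = a] can be replaced by [0] when it is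
    negative: the bound is only weakened where [h > a], and holds by hypothesis
    where [h <= a]. *)
Lemma slater_multiplier C g h (a b : R) y : convex_set C ->
  dual g -> dual h -> (forall x, C x -> h x <= a -> g x <= b) ->
  C y -> h y < a ->
  exists2 mu, 0 <= mu & forall x, C x -> g x <= b + mu * (h x - a).
Proof.
move=> Ccvx dg dh gb Cy hy.
have [[z [Cz hz]]|noz] := pselect (exists z, C z /\ a < h z); last first.
  exists 0 => // x Cx; rewrite mul0r addr0; apply: gb => //.
  by rewrite leNgt; apply/negP => hx; apply: noz; exists x.
have [|mu mub] := @crossing_multiplier C g h a b y z Ccvx dg dh _ Cy hy Cz hz.
  by move=> x Cx hx; apply: gb => //; rewrite hx.
exists (Num.max mu 0) => [|x Cx]; first by rewrite le_max lexx orbT.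
have [mu0|mu0] := leP 0 mu; first exact: mub.
rewrite mul0r addr0.
have [hx|hx] := leP (h x) a; first exact: gb.
have := mub _ Cx; have : 0 <= - mu * (h x - a).
  by apply: mulr_ge0; lra.
lra.
Qed.

(** * Points where only constant functionals attain their maximum *)

(** Equivalently, the normal cone to [C] at [x0] is a linear subspace; this is
    the dual description of quasi-relative interiority. *)
Definition quasi_interior C x0 := C x0 /\
  forall h, dual h -> (forall x, C x -> h x <= h x0) ->
    forall x, C x -> h x = h x0.

Lemma qri_quasi_interior C x0 : qri C x0 -> quasi_interior C x0.
Proof.
move=> [Cx0 [L0 Llin]]; split=> // h dh hmax x Cx.
set K := cone _ in L0 Llin.
have hN y : h (- y) = - h y.
  have := dual_combination (-1) 0 y 0 dh.
  by rewrite scaler0 addr0 scaleN1r; lra.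
have clos : closed [set y | h y <= 0].
  exact: (closed_comp (f := h) (fun y _ => dh.2 y) (@closed_le R 0)).
have Kneg : K `<=` [set y | h y <= 0].
  move=> _ [t t0 [_ [y Cy <-] <-]] /=; have := hmax _ Cy.
  have := dual_combination t 0 (y - x0) 0 dh.
  rewrite scaler0 addr0 mul0r addr0 dualB // => -> le_h.
  by apply: mulr_ge0_le0 => //; lra.
have Lneg y : closure K y -> h y <= 0.
  by move=> /(closure_subset Kneg); rewrite -(closure_id _).1.
have Kx : closure K (x - x0).
  apply: subset_closure; exists 1 => //=.
  by exists (x - x0); [exists x|rewrite scale1r].
have KNx : closure K (- (x - x0)).
  have := Llin (-1) (x - x0) 0; rewrite addr0 scaleN1r => /(_ _ _)/asboolP.
  by apply => //; apply/asboolP.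
have := Lneg _ Kx; have := Lneg _ KNx; rewrite hN dualB //; lra.
Qed.

(** A hyperplane through a quasi-interior point of [C] either contains [C] or
    has points of [C] strictly on both sides; in both cases a bound on the
    slice extends to [C], with a multiplier of arbitrary sign. *)
Lemma hyperplane_multiplier C x0 g h (b : R) : convex_set C ->
  quasi_interior C x0 -> dual g -> dual h ->
  (forall x, C x -> h x = h x0 -> g x <= b) ->
  exists mu, forall x, C x -> g x <= b + mu * (h x - h x0).
Proof.
move=> Ccvx [Cx0 qi] dg dh gb.
have flat : (forall x, C x -> h x = h x0) ->
    exists mu, forall x, C x -> g x <= b + mu * (h x - h x0).
  by move=> hC; exists 0 => x Cx; rewrite mul0r addr0; exact: gb (hC _ Cx).
have [[z [Cz hz]]|noz] := pselect (exists z, C z /\ h x0 < h z); last first.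
  apply/flat/qi => // x Cx.
  by rewrite leNgt; apply/negP => hx; apply: noz; exists x.
have [[y [Cy hy]]|noy] := pselect (exists y, C y /\ h y < h x0); last first.
  apply: flat => x Cx; apply: oppr_inj.
  apply: (qi _ (dualN dh)) Cx => {}x Cx; rewrite lerN2 leNgt.
  by apply/negP => hx; apply: noy; exists x.
exact: crossing_multiplier dg dh gb Cy hy Cz hz.
Qed.

(** A functional maximal at [x0] on the slice becomes, after subtracting a
    multiple of [h], maximal at [x0] on [C], hence constant there. *)
Lemma quasi_interior_hyperplane C x0 h : convex_set C ->
  quasi_interior C x0 -> dual h ->
  quasi_interior (C `&` [set x | h x = h x0]) x0.
Proof.
move=> Ccvx qi dh; have [Cx0 qi0] := qi; split=> // g dg gmax x [Cx hx].
have [|mu mub] := @hyperplane_multiplier C x0 g h (g x0) Ccvx qi dg dh.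
  by move=> y Cy hy; exact: gmax.
have := qi0 _ (dual_axpy (- mu) dh dg) _ x Cx; rewrite /= hx.
by move=> /(_ _)/addrI; apply => y Cy; have := mub _ Cy; lra.
Qed.

(** The constraint is inactive at [x0], so a functional that is maximal at [x0]
    under the constraint is already maximal there on all of [C]. *)
Lemma quasi_interior_halfspace C x0 h (a : R) : convex_set C ->
  quasi_interior C x0 -> dual h -> h x0 < a ->
  quasi_interior (C `&` [set x | h x <= a]) x0.
Proof.
move=> Ccvx [Cx0 qi] dh ha; split; first by split=> //; exact: ltW.
move=> g dg gmax x [Cx _]; apply: qi Cx => // {}x Cx.
have [|mu mu0 mub] := @slater_multiplier C g h a (g x0) x0 Ccvx dg dh _ Cx0 ha.
  by move=> y Cy hy; exact: gmax.
(* evaluating the multiplier inequality at x0 forces the multiplier to vanish *)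
have := mub _ Cx0; have := mub _ Cx.
have [->|mu_neq0] := eqVneq mu 0; first by rewrite mul0r addr0.
have : 0 < mu * (a - h x0) by rewrite mulr_gt0 ?subr_gt0 // lt0r mu_neq0.
lra.
Qed.

(** A functional maximal at the midpoint is maximal at both ends. *)
Lemma quasi_interior_midpoint C x0 x1 : convex_set C ->
  quasi_interior C x0 -> C x1 ->
  quasi_interior C (2^-1 *: x0 + (1 - 2^-1) *: x1).
Proof.
move=> Ccvx [Cx0 qi] Cx1; split.
  by apply: convex_segment => //; apply/andP; split; lra.
move=> h dh; rewrite dual_combination // => hmax x Cx.
have := hmax _ Cx0; have := hmax _ Cx1 => h1 h0.
have hx0 : forall y, C y -> h y = h x0.
  by apply: qi => // y Cy; have := hmax _ Cy; lra.
by rewrite (hx0 _ Cx) (hx0 _ Cx1); lra.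
Qed.

(** * Lagrange multipliers for polyhedral constraints *)

(** The statement quantifies over [C], [g] and [b] after [k], because the
    inductive step uses it on a half-space section and a slice of [C], and on
    [C] itself with the opposite of the removed constraint as objective. *)
Lemma polyhedral_multipliers k (f : 'I_k -> X -> R) (alpha : 'I_k -> R) :
  (forall i, dual (f i)) ->
  forall C x0 g b, convex_set C -> quasi_interior C x0 ->
    (forall i, f i x0 <= alpha i) -> dual g ->
    (forall x, C x -> (forall i, f i x <= alpha i) -> g x <= b) ->
  exists2 lam : 'I_k -> R, (forall i, 0 <= lam i) &
    forall x, C x -> g x <= b + \sum_i lam i * (f i x - alpha i).
Proof.
elim: k f alpha => [|k IH] f alpha df C x0 g b Ccvx qi fx0 dg gb.
  exists (fun=> 0) => // x Cx; rewrite big_ord0 addr0.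
  by apply: gb => // -[].
pose h := f ord0; pose a := alpha ord0.
pose f' i := f (lift ord0 i); pose alpha' i := alpha (lift ord0 i).
have df' i : dual (f' i) by exact: df.
have dh : dual h by exact: df.
have feasible x : h x <= a -> (forall i, f' i x <= alpha' i) ->
    forall i, f i x <= alpha i.
  by move=> hx f'x i; case: (unliftP ord0 i) => [j|] ->; [exact: f'x|exact: hx].
pose s (lam : 'I_k -> R) x := \sum_i lam i * (f' i x - alpha' i).
have sE lam x : s lam x = \sum_i lam i * f' i x - \sum_i lam i * alpha' i.
  by rewrite /s -sumrB; apply: eq_bigr => i _; rewrite mulrBr.
have dg_sub lam : dual (fun x => -1 * (\sum_i lam i * f' i x) + g x).
  exact: dual_axpy (dual_sum _ df') dg.
pose ext (mu : R) (lam : 'I_k -> R) (i : 'I_k.+1) :=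
  if unlift ord0 i is Some j then lam j else mu.
suff [mu [lam [mu0 lam0 bnd]]] : exists mu lam, [/\ 0 <= mu,
    forall i, 0 <= lam i &
    forall x, C x -> g x <= b + (mu * (h x - a) + s lam x)].
  exists (ext mu lam) => [i|x Cx].
    by rewrite /ext; case: unlift.
  rewrite big_ord_recl /ext unlift_none.
  by under eq_bigr => i _ do rewrite liftK; exact: bnd.
have [[x1 [Cx1 hx1 f'x1]]|tight] := pselect (exists x1,
    [/\ C x1, h x1 < a & forall i, f' i x1 <= alpha' i]).
- set m := 2^-1 *: x0 + (1 - 2^-1) *: x1.
  have qm : quasi_interior C m by exact: quasi_interior_midpoint.
  have hm : h m < a.
    by rewrite dual_combination //; have := fx0 ord0; rewrite -/h -/a; lra.
  have f'm i : f' i m <= alpha' i.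
    rewrite dual_combination //; have := f'x1 i; have := fx0 (lift ord0 i).
    by rewrite -/(f' i) -/(alpha' i); lra.
  have Ccvx' : convex_set (C `&` [set x | h x <= a]).
    apply: (@convex_slice _ _ C [set r | r <= a]) => // r u t t01 /= ra ua.
    have [t0 t1] := andP t01.
    have : t * r <= t * a by rewrite ler_wpM2l.
    have : (1 - t) * u <= (1 - t) * a by rewrite ler_wpM2l // subr_ge0.
    lra.
  have [|lam lam0 bnd] := IH f' alpha' df' _ m g b Ccvx'
      (quasi_interior_halfspace Ccvx qm dh hm) f'm dg.
    by move=> x [Cx hx] f'x; exact/gb/feasible.
  have [|mu mu0 mub] := @slater_multiplier C _ h a
      (b - \sum_i lam i * alpha' i) m Ccvx (dg_sub lam) dh _ qm.1 hm.
    by move=> x Cx hx; have := bnd _ (conj Cx hx); rewrite -/(s lam x) sE; lra.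
  exists mu, lam; split=> // x Cx; have := mub _ Cx; rewrite sE; lra.
(* from here on, h >= a at every point of C satisfying the other constraints *)
have hx0 : h x0 = a.
  apply/eqP; rewrite eq_le fx0 leNgt /=; apply/negP => hx0; apply: tight.
  by exists x0; split=> //; [exact: qi.1|move=> i; exact: fx0].
have [|nu nu0 nub] := IH f' alpha' df' _ x0 _ (- a) Ccvx qi
    (fun i => fx0 _) (dualN dh).
  move=> x Cx f'x; rewrite lerN2 leNgt; apply/negP => hx.
  by apply: tight; exists x.
have Ccvx0 : convex_set (C `&` [set x | h x = h x0]).
  apply: (@convex_slice _ _ C [set r | r = h x0]) => // r u t _ /= -> ->.
  by ring.
have [|lam lam0 bnd] := IH f' alpha' df' _ x0 g b Ccvx0
    (quasi_interior_hyperplane Ccvx qi dh) (fun i => fx0 _) dg.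
  by move=> x [Cx hx] f'x; apply/gb/feasible => //; rewrite hx hx0.
have [|mu mub] := @hyperplane_multiplier C x0 _ h
    (b - \sum_i lam i * alpha' i) Ccvx qi (dg_sub lam) dh.
  by move=> x Cx hx; have := bnd _ (conj Cx hx); rewrite -/(s lam x) sE; lra.
rewrite hx0 in mub.
(* adding M times the relation a - h <= s nu repairs the sign of mu *)
pose M := Num.max (- mu) 0.
have M0 : 0 <= M by rewrite le_max lexx orbT.
have muM : 0 <= mu + M.
  by have : - mu <= M; [rewrite le_max lexx|lra].
exists (mu + M), (fun i => lam i + M * nu i); split=> // [i|x Cx].
  by rewrite addr_ge0 ?mulr_ge0.
have -> : s (fun i => lam i + M * nu i) x = s lam x + M * s nu x.
  rewrite /s mulr_sumr -big_split; apply: eq_bigr => i _ /=; ring.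
have : M * (a - h x) <= M * s nu x.
  by rewrite ler_wpM2l //; have := nub _ Cx; rewrite -/(s nu x); lra.
have := mub _ Cx; rewrite (sE lam); lra.
Qed.

End Multipliers.

(** * The normal cone intersection rule *)

Theorem theorem4p1 (R : realType) (X : tvsType R) (P Omega : set X)
    (P0 : P !=set0) (Omega0 : Omega !=set0)
    (cvxP : convex_set P) (cvxOmega : convex_set Omega)
    (polyP : polyhedron P) (PqriOmega : P `&` qri Omega !=set0) :
  forall xbar : X, (P `&` Omega) xbar ->
    normal_cone xbar (P `&` Omega) =
      minkowski_sum (normal_cone xbar P) (normal_cone xbar Omega).
Proof.
move=> xbar [Pxbar Oxbar]; apply/seteqP; split=> g; last first.
  move=> [g1 [_ dg1 g1P] [g2 [_ dg2 g2O] <-]]; split=> // [|x [Px Ox]].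
    have := dual_axpy 1 dg1 dg2; congr dual.
    by apply/funext => x; rewrite mul1r.
  by rewrite addrfctE; have := g1P _ Px; have := g2O _ Ox; lra.
move=> [_ dg gN].
have [k [f [alpha [df PE]]]] := polyP.
have [x0 [Px0 qx0]] := PqriOmega.
have inP x : P x -> forall i, f i x <= alpha i by rewrite PE.
have [|lam lam0 bnd] := polyhedral_multipliers df cvxOmega
    (qri_quasi_interior qx0) (inP _ Px0) dg (b := g xbar).
  move=> x Ox fx; have := gN x; rewrite dualB // subr_le0; apply.
  by split=> //; rewrite PE.
pose s x := \sum_i lam i * f i x.
pose c := \sum_i lam i * alpha i.
have bound x : Omega x -> g x <= g xbar + (s x - c).
  move=> /bnd; congr (_ <= _ + _); rewrite -sumrB.
  by apply: eq_bigr => i _; rewrite mulrBr.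
have ds : dual s by exact: dual_sum.
have s_le x : P x -> s x <= c.
  by move=> Px; apply: ler_sum => i _; rewrite ler_wpM2l //; exact: inP.
have sxbar : s xbar = c.
  by have := bound _ Oxbar; have := s_le _ Pxbar; lra.
exists s.
  by split=> // x Px; rewrite dualB // sxbar subr_le0; exact: s_le.
exists (fun x => -1 * s x + g x).
  split=> // [|x Ox]; first exact: dual_axpy.
  rewrite (dualB x xbar ds) (dualB x xbar dg).
  by have := bound _ Ox; rewrite -sxbar; lra.
by apply/funext => x; rewrite addrfctE; ring.
Qed.
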